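(* Let $\mathcal{I}\subseteq B$ be a set of pairs with $R_{kl}>0$ for all $kl\in\mathcal{I}$. If there exists an optimal solution $u^*$ of $(D)$ with $r_{kl}(u^* )=R_{kl}$ for all $kl\in\mathcal{I}$, then the pairs of $\mathcal{I}$ are pairwise opt-disjoint, i.e. for any two distinct pairs $kl,ab\in\mathcal{I}$ the set of optimal solutions of $(P_{|kl})$ and the set of optimal solutions of $(P_{|ab})$ are disjoint.
   Context: Setting. $X_1,\dots,X_n$ are variables with finite domains $D(X_i)\subset\mathbb{Z}$, and $C$ is a constraint on them, i.e. a set of allowed tuples. A support for $C$ is an allowed tuple $\langle a_1,\dots,a_n\rangle$ with $a_i\in D(X_i)$ for all $i$. $B=\{ij : 1\le i\le n,\ j\in D(X_i)\}$ is the (finite) set of variable/value pairs, where $ij$ is short for $(i,j)$. The characteristic vector of a support is $x\in\{0,1\}^{B}$ with $x_{ij}=1$ iff $a_i=j$; $\mathcal{S}$ is the set of characteristic vectors of the supports of $C$. Each pair has a cost $c_{ij}\in\mathbb{Z}$. Ideal formulation (standing assumption): $A$ is a real $m\times|B|$ matrix (with columns $A_{ij}$, $ij\in B$) and $b\in\mathbb{R}^m$ are such that $\{x\in\mathbb{R}^{B}_+ : Ax\ge b\}=\mathrm{conv}(\mathcal{S})$. $(P)$: $z^*=\min\{cx : Ax\ge b,\ x\in\mathbb{R}^B_+\}$; $(D)$: $\max\{ub : uA\le c,\ u\in\mathbb{R}^m_+\}$. For $kl\in B$, $(P_{|kl})$ is $(P)$ with the additional constraint $x_{kl}=1$, with optimal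 value $z^*_{|kl}$. Feasibility (standing assumption): every pair of $B$ belongs to at least one support of $C$; hence $(P)$, $(D)$ and all $(P_{|kl})$ are feasible and bounded. For feasible $u$ of $(D)$ the reduced cost of $kl$ is $r_{kl}(u)=c_{kl}-uA_{kl}$. $R_{kl}=z^*_{|kl}-z^*$. *)

(* Defs.v *)
From mathcomp Require Import all_boot all_order all_algebra finmap.
From mathcomp Require Import mathcomp_extra boolp classical_sets reals convex.

Set Implicit Arguments.
Unset Strict Implicit.
Unset Printing Implicit Defensive.

Import Order.TTheory GRing.Theory Num.Theory.

Local Open Scope classical_set_scope.
Local Open Scope ring_scope.

(* B = {(i, j) : j in D(X_i)}, with variables numbered from 0. *)
Definition pairs (n : nat) (D : 'I_n -> {fset int}) : finType :=
  {i : 'I_n & D i}.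

Definition pvar n (D : 'I_n -> {fset int}) (ij : pairs D) : 'I_n := tag ij.

Definition pval n (D : 'I_n -> {fset int}) (ij : pairs D) : int :=
  val (tagged ij).

(* A constraint is the set of its allowed tuples, which need not lie in the
   product of the domains. *)
Definition is_support n (D : 'I_n -> {fset int}) (C : set (n.-tuple int))
    (a : n.-tuple int) : Prop :=
  C a /\ forall i, tnth a i \in D i.

(* A vector indexed by B is stored as a column of height #|B|; the entry of
   the pair ij sits at row [enum_rank ij]. *)
Definition charvec (R : realType) n (D : 'I_n -> {fset int})
    (a : n.-tuple int) : 'cV[R]_#|pairs D| :=
  \col_k (tnth a (pvar (enum_val k)) == pval (enum_val k))%:R.

Definition support_vectors (R : realType) n (D : 'I_n -> {fset int})
    (C : set (n.-tuple int)) : set 'cV[R]_#|pairs D| :=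
  @charvec R n D @` is_support D C.

Arguments support_vectors R {n} D C.

Definition convex_hull (R : realType) (E : lmodType R) (S : set E) : set E :=
  smallest (@convex_set R E) S.

Definition mx_le (R : realType) p q (M N : 'M[R]_(p, q)) : Prop :=
  forall i j, M i j <= N i j.

(* The minimum of a set of reals; a meaningless default if there is none. *)
Definition min_value (R : realType) (Z : set R) : R :=
  xget 0 [set z | Z z /\ lbound Z z].

Lemma min_valueE (R : realType) (Z : set R) (z : R) :
  Z z -> lbound Z z -> min_value Z = z.
Proof.
move=> Zz lbz; rewrite /min_value; case: xgetP => [y _ [Zy lby]|/(_ z)[]//].
by apply/eqP; rewrite eq_le lby //= lbz.
Qed.

(* (P) is min {cx : Ax >= b, x >= 0}, with dual (D) max {ub : uA <= c, u >= 0};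
   the prefix [Pfix] is for (P) with the additional constraint x_kl = 1. *)
Section LinearPrograms.
Variables (R : realType) (n : nat) (D : 'I_n -> {fset int}).
Variables (m : nat) (A : 'M[R]_(m, #|pairs D|)) (b : 'cV[R]_m).
Variable c : pairs D -> int.

Definition cost_row : 'rV[R]_#|pairs D| := \row_k (c (enum_val k))%:~R.

Definition cost (x : 'cV[R]_#|pairs D|) : R := (cost_row *m x) 0 0.

Definition P_feasible : set 'cV[R]_#|pairs D| :=
  [set x | mx_le 0 x /\ mx_le b (A *m x)].

Definition Pfix_feasible (kl : pairs D) : set 'cV[R]_#|pairs D| :=
  [set x | P_feasible x /\ x (enum_rank kl) 0 = 1].

Definition P_value : R := min_value (cost @` P_feasible).

Definition Pfix_value (kl : pairs D) : R :=
  min_value (cost @` Pfix_feasible kl).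

Definition Pfix_optimal (kl : pairs D) : set 'cV[R]_#|pairs D| :=
  [set x | Pfix_feasible kl x /\
           forall y, Pfix_feasible kl y -> cost x <= cost y].

Definition D_feasible : set 'rV[R]_m :=
  [set u | mx_le 0 u /\ mx_le (u *m A) cost_row].

Definition dual_obj (u : 'rV[R]_m) : R := (u *m b) 0 0.

Definition D_optimal : set 'rV[R]_m :=
  [set u | D_feasible u /\
           forall v, D_feasible v -> dual_obj v <= dual_obj u].

Definition reduced_cost (u : 'rV[R]_m) (kl : pairs D) : R :=
  (c kl)%:~R - (u *m col (enum_rank kl) A) 0 0.

Definition exact_reduced_cost (kl : pairs D) : R := Pfix_value kl - P_value.

Definition opt_disjoint (kl ab : pairs D) : Prop :=
  Pfix_optimal kl `&` Pfix_optimal ab = set0.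

End LinearPrograms.

(* Main.v *)
(* An optimal dual solution u has value z* by strong duality (Farkas' lemma;
   z* is attained because conv(S) is spanned by the finite set S).  For any
   feasible x of (P),
     cx = ub + u (Ax - b) + \sum_ij r_ij(u) x_ij >= z* + \sum_ij r_ij(u) x_ij.
   If x were optimal for both (P_|kl) and (P_|ab), then cx = z* + R_kl, while
   x_kl = x_ab = 1 makes the right-hand side at least z* + R_kl + R_ab,
   contradicting R_ab > 0. *)
Require Import Defs.
From mathcomp Require Import all_boot all_order all_algebra finmap.
From mathcomp Require Import boolp classical_sets reals convex.
From mathcomp Require Import cardinality interval_inference lra.

Set Implicit Arguments.
Unset Strict Implicit.

Import Order.TTheory GRing.Theory Num.Theory.

Local Open Scope classical_set_scope.
Local Open Scope ring_scope.

Lemma mulmx_ge0 (R : realType) (m n p : nat) (A : 'M[R]_(m, n))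
    (B : 'M[R]_(n, p)) :
  mx_le 0 A -> mx_le 0 B -> mx_le 0 (A *m B).
Proof.
move=> A0 B0 i j; rewrite !mxE; apply: sumr_ge0 => k _.
by apply: mulr_ge0; [have := A0 i k | have := B0 k j]; rewrite mxE.
Qed.

Lemma mx11_eq (R : nmodType) (A B : 'M[R]_1) : A 0 0 = B 0 0 -> A = B.
Proof. by move=> AB; apply/matrixP => i j; rewrite !ord1. Qed.

(* Induction on the number of rows, following Bartl: if the first row [a] is
   needed, it is negative at some x0 where the others are nonnegative and g is
   negative; restricting to ker a along x0 leaves one row fewer. *)
Lemma farkas (R : realType) (n m : nat) (M : 'M[R]_(m, n)) (g : 'rV[R]_n) :
  (forall x : 'cV[R]_n, mx_le 0 (M *m x) -> 0 <= (g *m x) 0 0) ->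
  exists2 l : 'rV[R]_m, mx_le 0 l & g = l *m M.
Proof.
elim: m M g => [|m IH] M g Mg.
  exists 0; first by move=> i; case.
  (* Without rows every [x] is allowed, so both signs of each unit vector force [g = 0]. *)
  rewrite mul0mx; apply/rowP => j; rewrite !mxE; apply/eqP.
  rewrite eq_le; apply/andP; split.
    have := Mg (- delta_mx j 0).
    by rewrite (mulmxN g) [leRHS]mxE -colE mxE oppr_ge0; apply; case.
  by have := Mg (delta_mx j 0); rewrite -(colE j g) [leRHS]mxE; apply; case.
rewrite -[m.+1]/(1 + m)%N in M Mg *.
rewrite -(vsubmxK M) in Mg *.
move: (usubmx M) (dsubmx M) Mg => a A {M} Mg.
have {}Mg (x : 'cV[R]_n) :
    0 <= (a *m x) 0 0 -> mx_le 0 (A *m x) -> 0 <= (g *m x) 0 0.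
  move=> ax Ax; apply: Mg => i j; rewrite mul_col_mx ord1 [leLHS]mxE mxE.
  case: splitP => k _; first by rewrite ord1.
  by have := Ax k 0; rewrite mxE.
have [Ag|/existsPNP[x0 Ax0 /negP]] :=
    pselect (forall x : 'cV[R]_n, mx_le 0 (A *m x) -> 0 <= (g *m x) 0 0).
  have [l l0 ->] := IH A g Ag.
  exists (row_mx 0 l); last by rewrite mul_row_col mul0mx add0r.
  move=> i j; rewrite ![leLHS]mxE mxE; case: splitP => k _; first by rewrite mxE.
  by have := l0 i k; rewrite mxE.
rewrite -ltNge => gx0.
have ax0 : (a *m x0) 0 0 < 0.
  by rewrite ltNge; apply: contraL gx0 => /Mg/(_ Ax0); rewrite -leNgt.
(* Scaled so that [a *m x1 = 1], which makes [P] below the projection onto the kernel of [a] along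
   [x0]. *)
pose x1 := ((a *m x0) 0 0)^-1 *: x0.
have ax1 : a *m x1 = 1%:M.
  by apply: mx11_eq; rewrite -scalemxAr [LHS]mxE [RHS]mxE mulVf // lt_eqF.
have ax0V : ((a *m x0) 0 0)^-1 <= 0 by rewrite invr_le0 ltW.
pose P := 1%:M - x1 *m a.
have aP : a *m P = 0 by rewrite mulmxBr mulmx1 mulmxA ax1 mul1mx subrr.
have [x|l l0 gP] := IH (A *m P) (g *m P).
  rewrite -!mulmxA => APx; apply: Mg => //.
  by rewrite mulmxA aP mul0mx mxE.
(* The multiplier of [a] is read off from [(g - l *m A) *m P = 0], that is,
   [g - l *m A = (g - l *m A) *m x1 *m a]. *)
exists (row_mx ((g - l *m A) *m x1) l); last first.
  have gAP : (g - l *m A) *m P = 0 by rewrite mulmxBl gP mulmxA subrr.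
  apply/eqP; rewrite mul_row_col -subr_eq -subr_eq0.
  by rewrite -gAP mulmxBr mulmx1 mulmxA.
move=> i j; rewrite ord1 {1}mxE [leRHS]mxE; case: splitP => k _; last first.
  by have := l0 0 k; rewrite mxE.
(* [x1] is a negative multiple of [x0], and [g *m x0 < 0 <= l *m A *m x0]. *)
rewrite ord1 mulmxBl -scalemxAr -[l *m A *m x1]mulmxA -scalemxAr -scalemxAr.
have lAx0 := mulmx_ge0 l0 Ax0 0 0.
rewrite -scalerBr mxE; apply: mulr_le0 => //.
rewrite !mxE in gx0 lAx0 *; rewrite subr_le0.
by apply: le_trans lAx0; apply: ltW.
Qed.

(** Here [z] is any lower bound of the primal; strong duality is the case where [z] is the primal
    optimum. *)
Lemma lp_strong_duality (R : realType) (m q : nat) (A : 'M[R]_(m, q))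
    (b : 'cV[R]_m) (c : 'rV[R]_q) (z : R) (x0 : 'cV[R]_q) :
  mx_le 0 x0 -> mx_le b (A *m x0) ->
  (forall x, mx_le 0 x -> mx_le b (A *m x) -> z <= (c *m x) 0 0) ->
  exists u : 'rV[R]_m, [/\ mx_le 0 u, mx_le (u *m A) c & z <= (u *m b) 0 0].
Proof.
move=> x00 Ax0 zP.
(* Homogenization: apply Farkas to Ax >= tb, x >= 0, t >= 0 ==> cx >= tz. *)
pose M : 'M[R]_(m + (q + 1), q + 1) := col_mx (row_mx A (- b)) 1%:M.
have [xt|l l0] := @farkas _ _ _ M (row_mx c (- z)%:M).
  rewrite -(vsubmxK xt); move: (usubmx xt) (dsubmx xt) => x t {xt}.
  rewrite /M mul_col_mx !mul_row_col mul1mx => Mxt.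
  have Axt i : b i 0 * t 0 0 <= (A *m x) i 0.
    have := Mxt (lshift _ i) 0; rewrite col_mxEu mulNmx [leLHS]mxE [leRHS]mxE.
    by rewrite [(- (b *m t)) i 0]mxE [(b *m t) i 0]mxE big_ord1 subr_ge0.
  have x_ge0 : mx_le 0 x.
    move=> i j; have := Mxt (rshift m (lshift 1 i)) j.
    by rewrite col_mxEd col_mxEu [leLHS]mxE [leLHS in _ -> leLHS <= _]mxE.
  have t_ge0 : 0 <= t 0 0.
    by have := Mxt (rshift m (rshift q 0)) 0; rewrite !col_mxEd mxE.
  rewrite mxE mul_scalar_mx [(_ *: (t : 'M_1)) 0 0]mxE mulNr subr_ge0.
  move: t_ge0; rewrite le_eqVlt => /predU1P[t0|t_gt0].
    rewrite -t0 mulr0 leNgt; apply/negP => cx.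
    (* For t = 0, x is a recession direction of the feasible set. *)
    pose s := ((c *m x0) 0 0 - z + 1) / - (c *m x) 0 0.
    have cx0 := zP _ x00 Ax0.
    have s_ge0 : 0 <= s by apply: divr_ge0; lra.
    have xs_ge0 : mx_le 0 (x0 + s *: x).
      move=> i j; have := x00 i j; have := x_ge0 i j; rewrite !mxE => xi x0i.
      by rewrite addr_ge0 // mulr_ge0.
    have Axs : mx_le b (A *m (x0 + s *: x)).
      move=> i j; rewrite ord1 mulmxDr -scalemxAr; apply: (le_trans (Ax0 i 0)).
      rewrite [leRHS]mxE lerDl [leRHS]mxE.
      by apply: mulr_ge0 => //; have := Axt i; rewrite -t0 mulr0.
    (* The step length [s] brings the cost down to [z - 1], below the bound. *)
    have := zP _ xs_ge0 Axs.
    rewrite mulmxDr -scalemxAr mxE [(s *: (_ : 'M_1)) 0 0]mxE.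
    rewrite (_ : s * _ = - ((c *m x0) 0 0 - z + 1)); first by lra.
    by rewrite /s invrN mulrN mulNr divfK // lt_eqF.
  (* For [t > 0], dividing by [t] gives a feasible point of the original program. *)
  have := zP ((t 0 0)^-1 *: x).
  rewrite -!scalemxAr [(_ *: (_ : 'M_1)) 0 0]mxE ler_pdivlMl // mulrC; apply.
    move=> i j; have := x_ge0 i j; rewrite !mxE => xi.
    by rewrite mulr_ge0 // invr_ge0 ltW.
  by move=> i j; rewrite ord1 [leRHS]mxE ler_pdivlMl // mulrC.
rewrite -(hsubmxK l) in l0 *.
move: (lsubmx l) (rsubmx l) l0 => u v uv0.
have u0 : mx_le 0 u.
  by move=> i j; have := uv0 i (lshift _ j); rewrite row_mxEl !mxE.
have v0 : mx_le 0 v.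
  by move=> i j; have := uv0 i (rshift _ j); rewrite row_mxEr !mxE.
(* The two parts of [v] are the slacks [c - u *m A] and [u *m b - z]. *)
rewrite /M mul_row_col mulmx1 mul_mx_row -(hsubmxK v) add_row_mx.
case/eq_row_mx => cE zE; exists u; split => //.
  move=> i j; rewrite cE [leRHS]mxE lerDl.
  by have := v0 i (lshift _ j); rewrite !mxE.
have := v0 0 (rshift q 0); move/matrixP/(_ 0 0): zE.
rewrite mulmxN mxE [in RHS]mxE [(- (_ : 'M_1)) 0 0]mxE.
rewrite [rsubmx _ _ _]mxE [X in X <= _]mxE.
by rewrite eqxx mulr1n; lra.
Qed.

Lemma seq_min (R : realDomainType) (T : eqType) (f : T -> R) (s : seq T) x0 :
  x0 \in s -> exists2 x, x \in s & forall y, y \in s -> f x <= f y.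
Proof.
elim: s x0 => // a [_ _ _|b s /(_ b (mem_head _ _)) [x xs xP] _ _].
  by exists a; rewrite ?mem_head // => y; rewrite inE => /eqP ->.
have [fx|fa] := leP (f x) (f a).
  by exists x => [|y]; rewrite inE ?xs ?orbT // => /predU1P[->|/xP].
exists a => [|y]; rewrite inE ?eqxx // => /predU1P[->//|/xP].
exact/le_trans/ltW.
Qed.

(** A half-space is convex, so it contains the hull as soon as it contains [S]. *)
Lemma convex_hull_lb (R : realType) (q : nat) (S : set 'cV[R]_q)
    (c : 'rV[R]_q) (z : R) :
  (forall x, S x -> z <= (c *m x) 0 0) ->
  forall x, convex_hull S x -> z <= (c *m x) 0 0.
Proof.
move=> Sz; apply: smallest_sub => // x y k.
rewrite !inE /= => zx zy.
rewrite mulmxDr -!scalemxAr [leRHS]mxE [X in X + _]mxE [X in _ + X]mxE.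
have k0 : 0 <= k%:num by [].
have k1 : k%:num <= 1 by [].
rewrite /unstable.onem; nra.
Qed.

Lemma convex_hull_min (R : realType) (q : nat) (S : set 'cV[R]_q)
    (c : 'rV[R]_q) :
  finite_set S -> S !=set0 ->
  exists2 x, convex_hull S x &
    forall y, convex_hull S y -> (c *m x) 0 0 <= (c *m y) 0 0.
Proof.
move=> /finite_seqP[s ->] [x0 /= x0s].
have [x xs xmin] := seq_min (fun x : 'cV[R]_q => (c *m x) 0 0) x0s.
exists x; first exact: sub_gen_smallest.
exact: convex_hull_lb.
Qed.

(** Characteristic vectors have 0/1 entries, so they are indexed by subsets of the rows, even if [C]
    is infinite. *)
Lemma finite_support_vectors (R : realType) (n : nat) (D : 'I_n -> {fset int})
    (C : set (n.-tuple int)) : finite_set (support_vectors R D C).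
Proof.
pose vec (T : {set 'I_#|pairs D|}) : 'cV[R]_#|pairs D| := \col_k (k \in T)%:R.
apply: (@sub_finite_set _ _ (range vec)); last exact: finite_image.
move=> _ [a _ <-].
exists [set k | tnth a (pvar (enum_val k)) == pval (enum_val k)]%SET => //.
by apply/colP => k; rewrite !mxE inE.
Qed.

Section ReducedCosts.
Variables (R : realType) (n : nat) (D : 'I_n -> {fset int}).
Variables (m : nat) (A : 'M[R]_(m, #|pairs D|)) (b : 'cV[R]_m).
Variable c : pairs D -> int.

Lemma weak_duality_reduced_cost (u : 'rV[R]_m) (x : 'cV[R]_#|pairs D|) :
  D_feasible A c u -> P_feasible A b x ->
  dual_obj b u + \sum_ij reduced_cost A c u ij * x (enum_rank ij) 0
    <= cost c x.
Proof.
move=> [u0 _] [_ Axb].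
have slack : mx_le 0 (A *m x - b).
  by move=> i j; have := Axb i j; rewrite !mxE subr_ge0.
(* This is the term [u (A x - b)] that is dropped from the cost. *)
have := mulmx_ge0 u0 slack 0 0.
rewrite mulmxBr [leLHS]mxE [leRHS]mxE [(- (_ : 'M_1)) 0 0]mxE subr_ge0 mulmxA => ubx.
rewrite -lerBrDr; apply: le_trans ubx _.
rewrite lerBrDr -lerBrDl /cost.
have -> : (cost_row R c *m x) 0 0 - (u *m A *m x) 0 0
          = ((cost_row R c - u *m A) *m x) 0 0.
  by rewrite mulmxBl [in RHS]mxE [X in _ = _ + X]mxE.
rewrite mxE (reindex (@enum_rank (pairs D))) /=; last first.
  exact/onW_bij/enum_rank_bij.
apply: ler_sum => ij _; rewrite !mxE enum_rankK /reduced_cost.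
rewrite [(u *m col _ _) 0 0]mxE.
by under eq_bigr do rewrite mxE.
Qed.

Lemma reduced_cost_ge0 (u : 'rV[R]_m) (ij : pairs D) :
  D_feasible A c u -> 0 <= reduced_cost A c u ij.
Proof.
move=> [_ /(_ 0 (enum_rank ij))].
rewrite /reduced_cost !mxE enum_rankK subr_ge0.
by under [X in _ -> X <= _]eq_bigr do rewrite mxE.
Qed.

(** As [kl] and [ab] are distinct, both terms can be split off the sum; the remaining ones are
    nonnegative. *)
Lemma weak_duality_two_pairs (u : 'rV[R]_m) (x : 'cV[R]_#|pairs D|)
    (kl ab : pairs D) :
  D_feasible A c u -> kl != ab ->
  Pfix_feasible A b kl x -> Pfix_feasible A b ab x ->
  dual_obj b u + (reduced_cost A c u kl + reduced_cost A c u ab) <= cost c x.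
Proof.
move=> uD klab [xP xkl] [_ xab].
apply: le_trans (weak_duality_reduced_cost uD xP).
rewrite lerD2l (bigD1 kl) //= (bigD1 ab) ?[ab == kl]eq_sym //=.
rewrite xkl xab !mulr1 lerD2l lerDl; apply: sumr_ge0 => ij _.
apply: mulr_ge0; first exact: reduced_cost_ge0.
by case: xP => /(_ (enum_rank ij) 0); rewrite mxE.
Qed.

Lemma Pfix_valueE (kl : pairs D) (x : 'cV[R]_#|pairs D|) :
  Pfix_optimal A b c kl x -> Pfix_value A b c kl = cost c x.
Proof.
move=> [xP xmin]; apply: min_valueE; first by exists x.
by move=> _ [y yP <-]; exact: xmin.
Qed.

(** Strong duality yields some dual feasible [v] of value at least the primal minimum, and [u] is no
    worse than [v]. *)
Lemma P_value_le_dual (u : 'rV[R]_m) (x : 'cV[R]_#|pairs D|) :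
  P_feasible A b x -> (forall y, P_feasible A b y -> cost c x <= cost c y) ->
  D_optimal A b c u -> P_value A b c <= dual_obj b u.
Proof.
move=> xP xmin [_ umax].
have -> : P_value A b c = cost c x.
  by apply: min_valueE; [exists x | move=> _ [y yP <-]; exact: xmin].
have [x0 Ax] := xP.
have [|v [v0 vA zv]] := lp_strong_duality (c := cost_row R c) (z := cost c x) x0 Ax.
  by move=> y y0 Ay; apply: xmin; split.
exact/(le_trans zv)/umax.
Qed.

End ReducedCosts.

Unset Implicit Arguments.

Theorem theorem3 (R : realType) (n : nat) (D : 'I_n -> {fset int})
  (C : set (n.-tuple int)) (c : pairs D -> int)
  (m : nat) (A : 'M[R]_(m, #|pairs D|)) (b : 'cV[R]_m)
  (ideal : P_feasible A b = convex_hull (support_vectors R D C))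
  (every_pair_supported : forall ij : pairs D,
     exists a, is_support D C a /\ tnth a (pvar ij) = pval ij)
  (I : {set pairs D})
  (R_pos : forall kl, kl \in I -> 0 < exact_reduced_cost A b c kl) :
  (exists u, D_optimal A b c u /\
     forall kl, kl \in I ->
       reduced_cost A c u kl = exact_reduced_cost A b c kl) ->
  forall kl ab, kl \in I -> ab \in I -> kl <> ab ->
    opt_disjoint A b c kl ab.
Proof.
move=> [u [uopt ru]] kl ab klI abI /eqP klab.
apply/seteqP; split=> // x [xkl xab].
have S0 : support_vectors R D C !=set0.
  have [a [aC _]] := every_pair_supported kl.
  by exists (charvec R D a), a.
have := convex_hull_min (cost_row R c) (finite_support_vectors R D C) S0.
rewrite -ideal => -[y yP ymin].
have zu := P_value_le_dual yP ymin uopt.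
have := weak_duality_two_pairs uopt.1 klab xkl.1 xab.1.
(* Only the reduced cost of [kl] is unfolded, to [cost c x] minus the value of (P); with [zu] this
   leaves that of [ab] at most 0. *)
rewrite !ru // {1}/exact_reduced_cost (Pfix_valueE xkl).
have := R_pos ab abI.
by lra.
Qed.
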